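(* Let $(X,\rho)$ be a metric space and let $\mathcal{B}$ be a bornology on $X$ with a closed base. Then $$\pi\chi(\tau_{\mathcal B})=\pi\chi(\tau^s_{\mathcal B})=\chi(\tau_{\mathcal B})=\chi(\tau^s_{\mathcal B})=u(\tau_{\mathcal B})=u(\tau^s_{\mathcal B})=cf(\mathcal B).$$
   Context: A bornology on a set $X$ is a family $\mathcal B$ of subsets of $X$ that is closed under taking subsets, closed under finite unions, and satisfies $\bigcup\mathcal B=X$. A base of $\mathcal B$ is a subfamily $\mathcal B_0\subset\mathcal B$ such that every $B\in\mathcal B$ is contained in some $B_0\in\mathcal B_0$; $\mathcal B$ has a closed base if it has a base consisting of closed sets (equivalently $\overline B\in\mathcal B$ for all $B\in\mathcal B$). Put $cf(\mathcal B)=\aleph_0+\min\{|\mathcal B_0|:\mathcal B_0\text{ is a base of }\mathcal B\}$. For $B\subset X$ and $\delta>0$, $B^\delta=\{x\in X:\exists b\in B,\ \rho(x,b)<\delta\}$. $C(X)$ is the set of continuous functions $X\to\mathbb R$. The topology $\tau_{\mathcal B}$ on $C(X)$ is induced by the uniformity with basic entourages $[B,\epsilon]=\{(f,g):\forall x\in B,\ |f(x)-g(x)|<\epsilon\}$, and $\tau^s_{\mathcal B}$ by the uniformity with basic entourages $[B,\epsilon]^s=\{(f,g):\exists\delta>0\ \forall x\in B^\delta,\ |f(x)-g(x)|<\epsilon\}$, where $B\in\mathcal B$, $\epsilon>0$. For a topology $\tau$ on $C(X)$, $\varphi(\tau)$ denotes the cardinal function $\varphi$ of the space $(C(X),\tau)$.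 Here $\chi$ is the character; $\pi\chi$ is the $\pi$-character (supremum over points $p$ of the least cardinality of a local $\pi$-base at $p$, i.e. a family of nonempty open sets such that every neighbourhood of $p$ contains a member of it); $u$ is the uniform weight (the least cardinality of a base of a uniformity inducing the topology). Convention: all cardinal functions are taken to be infinite, i.e. $\aleph_0$ is added to their value. *)

(* Defs.v *)
From HB Require Import structures.
From mathcomp Require Import all_boot all_order all_algebra.
From mathcomp Require Import all_classical all_reals all_analysis.

Set Implicit Arguments.
Unset Strict Implicit.
Unset Printing Implicit Defensive.

Import Order.TTheory GRing.Theory Num.Theory.
Import numFieldTopology.Exports.

Local Open Scope classical_set_scope.
Local Open Scope card_scope.
Local Open Scope ring_scope.

(* A cardinal is an equipotency class of types, so that equality of cardinals
   is Leibniz equality. *)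
Record cardinal := Cardinal {
  cardinal_class : Type -> Prop ;
  cardinalP : exists A : Type,
    cardinal_class = (fun B : Type => [set: A] #= [set: B]) }.

Definition card_of (A : Type) : cardinal :=
  @Cardinal (fun B : Type => [set: A] #= [set: B]) (ex_intro _ A erefl).

Definition card_repr (k : cardinal) : Type := projT1 (cid (cardinalP k)).

Definition cle (k l : cardinal) : Prop :=
  [set: card_repr k] #<= [set: card_repr l].

Definition cadd (k l : cardinal) : cardinal :=
  card_of (card_repr k + card_repr l)%type.

Definition aleph0 : cardinal := card_of nat.

Definition is_cmin (S : cardinal -> Prop) (k : cardinal) : Prop :=
  S k /\ forall l, S l -> cle k l.

(* The default value is only reached when S is empty, see cminP. *)
Definition cmin (S : cardinal -> Prop) : cardinal :=
  if pselect (exists k, is_cmin S k) is left h then projT1 (cid h)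
  else card_of void.

Definition csup (I : Type) (f : I -> cardinal) : cardinal :=
  cmin (fun k => forall i, cle (f i) k).

Lemma card_reprK (k : cardinal) : card_of (card_repr k) = k.
Proof.
rewrite /card_of /card_repr; case: k => P h /=; case: (cid _) => A /= e.
by move: h; rewrite e => h; congr Cardinal; exact: Prop_irrelevance.
Qed.

Lemma card_ofP (A B : Type) :
  card_of A = card_of B <-> [set: A] #= [set: B].
Proof.
split=> [[/(congr1 (fun P => P B)) e]|AB]; first by rewrite e card_eqxx.
rewrite /card_of.
set a := ex_intro _ _ _; set b := ex_intro _ _ _; move: a b.
rewrite (_ : (fun C : Type => [set: A] #= [set: C] : Prop) =
             (fun C : Type => [set: B] #= [set: C] : Prop)).
  by move=> a b; congr Cardinal; exact: Prop_irrelevance.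
by apply/funext => C; rewrite (card_eql AB).
Qed.

Lemma card_of_repr (A : Type) : [set: card_repr (card_of A)] #= [set: A].
Proof. by apply/card_ofP; rewrite card_reprK. Qed.

Lemma cle_card_of (A B : Type) :
  cle (card_of A) (card_of B) <-> [set: A] #<= [set: B].
Proof.
by rewrite /cle (card_le_eql (card_of_repr A)) (card_le_eqr (card_of_repr B)).
Qed.

Lemma cle_refl (k : cardinal) : cle k k.
Proof. exact: card_lexx. Qed.

Lemma cle_trans (k l m : cardinal) : cle k l -> cle l m -> cle k m.
Proof. exact: card_le_trans. Qed.

Lemma cle_anti (k l : cardinal) : cle k l -> cle l k -> k = l.
Proof.
move=> kl lk; rewrite -(card_reprK k) -(card_reprK l); apply/card_ofP.
by rewrite card_eq_le; apply/andP; split.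
Qed.

Lemma inj_card (A B : Type) (f : A -> B) :
  injective f -> [set: A] #<= [set: B].
Proof.
move=> finj; suff /injfunPex[g] : exists2 g : A -> B,
    set_fun setT setT g & set_inj setT g by exact: (inj_card_le g).
by exists f => // y z _ _; exact: finj.
Qed.

Lemma card_le_inj (A B : Type) :
  [set: A] #<= [set: B] -> exists f : A -> B, injective f.
Proof.
move=> /card_leP/injfunPex[f _ finj].
exists (fun a => \val (f (SigSub (mem_set (I : [set: A] a))))) => a b /val_inj.
by move=> /finj; rewrite !in_setT => /(_ isT isT) [].
Qed.

(* The cardinals are well ordered: take a maximal family F of choice functions
   that pairwise differ at every index. Some evaluation map is onto, otherwise F
   could be extended; all of them are injective on F. *)
Lemma card_le_min (I : Type) (i0 : I) (A : I -> Type) :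
  exists i, forall j, [set: A i] #<= [set: A j].
Proof.
pose T := forall i : I, A i.
pose P (F : set T) := forall f g, F f -> F g -> forall i, f i = g i -> f = g.
have [F PF maxF] : exists2 F, P F & forall G, F `<` G -> ~ P G.
  have [|F [PF mF]] := @Zorn_bigcup T P; last by exists F => // G /mF.
  move=> H HP tot f g [U HU Uf] [V HV Vg] i fg.
  have [UV|VU] := tot _ _ HU HV.
    by apply: (HP _ HV) fg => //; exact: UV.
  by apply: (HP _ HU) fg => //; exact: VU.
have [i surjF] : exists i : I, forall y, exists2 f, F f & f i = y.
  apply: contrapT => /forallNP nsurj.
  have {nsurj} [f fP] : exists f : T, forall i g, F g -> g i <> f i.
    have {}nsurj i : exists y, forall g, F g -> g i <> y.
      apply: contrapT => /forallNP h; apply: (nsurj i) => y.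
      have /existsNP [g /not_implyP [Fg /contrapT gi]] := h y.
      by exists g.
    by exists (fun i => projT1 (cid (nsurj i))) => i; case: cid.
  apply: (maxF (F `|` [set f])).
    split=> [|sub]; first exact: subsetUl.
    have Ff : F f by apply: sub; right.
    exact: (fP i0 f Ff).
  move=> g h [Fg|->] [Fh|->] j //; first exact: PF.
    by move/fP => /(_ Fg).
  by move/esym/fP => /(_ Fh).
have [s sP] : exists s : A i -> T, forall y, F (s y) /\ s y i = y.
  have h y : exists f, F f /\ f i = y by have [f] := surjF y; exists f.
  by exists (fun y => projT1 (cid (h y))) => y; case: cid.
exists i => j.
apply: (@inj_card _ _ (fun y => s y j)) => y z /= syz.
have [[Fy <-] [Fz <-]] := (sP y, sP z).
by rewrite (PF _ _ Fy Fz j syz).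
Qed.

Lemma cle_total (k l : cardinal) : cle k l \/ cle l k.
Proof.
have [[] h] := card_le_min true (fun b => card_repr (if b then k else l)).
  by left; exact: (h false).
by right; exact: (h true).
Qed.

Lemma cle_sub (k l : cardinal) :
  cle k l -> exists D : card_repr l -> Prop, k = card_of {x | D x}.
Proof.
move=> /card_le_inj[g ginj].
exists (fun x => exists y, g y = x).
rewrite -[LHS]card_reprK; apply/card_ofP; rewrite card_eq_le; apply/andP; split.
  apply: (@inj_card _ _ (fun y => exist _ (g y) (ex_intro _ y erefl))).
  by move=> y z [] /ginj.
apply: (@inj_card _ _ (fun x => proj1_sig (cid (proj2_sig x)))).
move=> [x hx] [y hy] /=; case: cid => a /= ga; case: cid => c /= gc ac.
by move: hx hy; rewrite -ga -gc ac => hx hy; congr exist; exact: Prop_irrelevance.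
Qed.

Lemma is_cmin_ex (S : cardinal -> Prop) :
  (exists k, S k) -> exists k, is_cmin S k.
Proof.
move=> [k0 Sk0]; pose I := {D : card_repr k0 -> Prop | S (card_of {x | D x})}.
have [D0 k0E] := cle_sub (cle_refl k0).
have i0 : I by exists D0; rewrite -k0E.
have [[D SD] Dmin] := card_le_min i0 (fun i => {x | proj1_sig i x}).
exists (card_of {x | D x}); split=> // l Sl.
have [lk0|k0l] := cle_total l k0.
  have [D' lE] := cle_sub lk0; have SD' := Sl; rewrite lE in SD'.
  by rewrite lE; apply/cle_card_of; exact: (Dmin (exist _ D' SD')).
have SD0 : S (card_of {x | D0 x}) by rewrite -k0E.
apply: cle_trans k0l; apply: (@cle_trans _ (card_of {x | D0 x})).
  by apply/cle_card_of; exact: (Dmin (exist _ D0 SD0)).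
by rewrite -k0E; exact: cle_refl.
Qed.

Lemma cminP (S : cardinal -> Prop) : (exists k, S k) -> is_cmin S (cmin S).
Proof.
by move=> /is_cmin_ex h; rewrite /cmin; case: pselect => // g; case: cid.
Qed.

Lemma cmin_in (S : cardinal -> Prop) : (exists k, S k) -> S (cmin S).
Proof. by move=> /cminP[]. Qed.

Lemma cmin_le (S : cardinal -> Prop) (k : cardinal) : S k -> cle (cmin S) k.
Proof. by move=> Sk; have [_] := cminP (ex_intro _ k Sk); exact. Qed.

Lemma csupP (I : Type) (f : I -> cardinal) :
  (forall i, cle (f i) (csup f)) /\
  (forall k, (forall i, cle (f i) k) -> cle (csup f) k).
Proof.
split; last by move=> k; exact: cmin_le.
apply: (@cmin_in (fun k => forall i, cle (f i) k)).
exists (card_of {i : I & card_repr (f i)}) => i.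
rewrite -[f i]card_reprK; apply/cle_card_of.
apply: (@inj_card _ _ (existT (fun i => card_repr (f i)) i)) => y z yz.
by have := projT2_eq yz; rewrite (Prop_irrelevance (projT1_eq yz) erefl).
Qed.

(* The least cardinality of a family of subsets of T satisfying P. *)
Definition min_card (T : Type) (P : set (set T) -> Prop) : cardinal :=
  cmin (fun k => exists2 F, P F & k = card_of (set_type F)).

Section cardinal_functions.
Variable T : topologicalType.

Definition local_base (p : T) (F : set (set T)) : Prop :=
  F `<=` open_nbhs p /\ forall V, nbhs p V -> exists2 U, F U & U `<=` V.

Definition local_pi_base (p : T) (F : set (set T)) : Prop :=
  F `<=` [set U | open U /\ U !=set0] /\
  forall V, nbhs p V -> exists2 U, F U & U `<=` V.

(* E is a uniformity inducing the topology of T; the axioms are those of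
   uniformType. *)
Definition compatible_uniformity (E : set_system (T * T)) : Prop :=
  [/\ Filter E,
      forall A, E A -> diagonal `<=` A,
      forall A, E A -> E A^-1%relation,
      forall A, E A -> exists2 B, E B & (B \; B)%relation `<=` A
    & nbhs = nbhs_ E :> (T -> set_system T)].

Definition uniformity_base (F : set (set (T * T))) : Prop :=
  exists E, [/\ compatible_uniformity E, F `<=` E
    & forall A, E A -> exists2 U, F U & U `<=` A].

Definition character : cardinal :=
  cadd aleph0 (csup (fun p : T => min_card (local_base p))).

Definition pi_character : cardinal :=
  cadd aleph0 (csup (fun p : T => min_card (local_pi_base p))).

Definition uniform_weight : cardinal :=
  cadd aleph0 (min_card uniformity_base).

End cardinal_functions.

(* Being closed under finite unions includes the empty union. *)
Record bornology (X : Type) := Bornology {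
  bornology_set :> set (set X) ;
  bornology_sub : forall A B, bornology_set B -> A `<=` B -> bornology_set A ;
  bornology0 : bornology_set set0 ;
  bornologyU : forall A B,
    bornology_set A -> bornology_set B -> bornology_set (A `|` B) ;
  bornology_cover : \bigcup_(A in bornology_set) A = setT }.

Definition bornology_base (X : Type) (B : bornology X) (F : set (set X)) :=
  F `<=` B /\ forall A, bornology_set B A -> exists2 C, F C & A `<=` C.

Definition has_closed_base (X : topologicalType) (B : bornology X) : Prop :=
  exists2 F, bornology_base B F & F `<=` closed.

Definition cf (X : Type) (B : bornology X) : cardinal :=
  cadd aleph0 (min_card (bornology_base B)).

Section function_spaces.
Variables (R : realType) (X : metricType R).

Definition enlargement (A : set X) (d : R) : set X :=
  [set x | exists2 b, A b & mdist x b < d].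

Definition born_ent (A : set X) (e : R) :
    set (continuousType X R * continuousType X R) :=
  [set fg : continuousType X R * continuousType X R | forall x, A x -> `|fg.1 x - fg.2 x| < e].

Definition strong_born_ent (A : set X) (e : R) :
    set (continuousType X R * continuousType X R) :=
  [set fg : continuousType X R * continuousType X R | exists2 d, 0 < d &
    forall x, enlargement A d x -> `|fg.1 x - fg.2 x| < e].

(* Two copies of C(X), carrying the topologies tau_B and tau^s_B. *)
Definition C_tau (B : bornology X) : Type := continuousType X R.
Definition C_tau_s (B : bornology X) : Type := continuousType X R.

HB.instance Definition _ B := Choice.on (C_tau B).
HB.instance Definition _ B := Choice.on (C_tau_s B).

Section uniformity.
Variable B : bornology X.

Definition tau_entourage : set_system (C_tau B * C_tau B) :=
  filter_from [set Ae : set X * R | bornology_set B Ae.1 /\ 0 < Ae.2]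
    (fun Ae => born_ent Ae.1 Ae.2).

Definition tau_s_entourage : set_system (C_tau_s B * C_tau_s B) :=
  filter_from [set Ae : set X * R | bornology_set B Ae.1 /\ 0 < Ae.2]
    (fun Ae => strong_born_ent Ae.1 Ae.2).

Let tau_filter : Filter tau_entourage.
Proof.
apply: filter_from_filter.
  by exists (set0, 1); split; [exact: bornology0|exact: ltr01].
move=> [A e] [A' e'] [/= BA e0] [/= BA' e'0].
exists (A `|` A', Num.min e e') => /=.
  by split; [exact: bornologyU|rewrite lt_min e0].
move=> fg H; split=> x Ax; have : `|fg.1 x - fg.2 x| < Num.min e e'.
- by apply: H; left.
- by rewrite lt_min => /andP[].
- by apply: H; right.
- by rewrite lt_min => /andP[].
Qed.

Let tau_diagonal A : tau_entourage A -> diagonal `<=` A.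
Proof.
move=> [[C e] [/= BC e0] CA] [f g] /= fg; apply: CA => x _ /=.
by rewrite (fg : f = g) subrr normr0.
Qed.

Let tau_inv A : tau_entourage A -> tau_entourage A^-1%relation.
Proof.
move=> [[C e] [/= BC e0] CA]; exists (C, e) => // -[f g] /= fg.
by apply: CA => x Cx /=; rewrite distrC; exact: fg.
Qed.

Let tau_split A : tau_entourage A ->
  exists2 D, tau_entourage D & (D \; D)%relation `<=` A.
Proof.
move=> [[C e] [/= BC e0] CA]; exists (born_ent C (e / 2)).
  by exists (C, e / 2) => //; split=> //=; rewrite divr_gt0.
move=> [f g] /= [h fh hg]; apply: CA => x Cx /=.
rewrite (le_lt_trans (ler_distD (h x) _ _))// (splitr e) ltrD//.
  exact: fh.
exact: hg.
Qed.

HB.instance Definition _ :=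
  isUniform.Build (C_tau B) tau_filter tau_diagonal tau_inv tau_split.

Let tau_s_filter : Filter tau_s_entourage.
Proof.
apply: filter_from_filter.
  by exists (set0, 1); split; [exact: bornology0|exact: ltr01].
move=> [A e] [A' e'] [/= BA e0] [/= BA' e'0].
exists (A `|` A', Num.min e e') => /=.
  by split; [exact: bornologyU|rewrite lt_min e0].
move=> fg [d d0 H]; split; exists d => // x [b Ab xb];
  have : `|fg.1 x - fg.2 x| < Num.min e e'.
- by apply: H; exists b => //; left.
- by rewrite lt_min => /andP[].
- by apply: H; exists b => //; right.
- by rewrite lt_min => /andP[].
Qed.

Let tau_s_diagonal A : tau_s_entourage A -> diagonal `<=` A.
Proof.
move=> [[C e] [/= BC e0] CA] [f g] /= fg; apply: CA => /=.
by exists 1 => // x _ /=; rewrite (fg : f = g) subrr normr0.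
Qed.

Let tau_s_inv A : tau_s_entourage A -> tau_s_entourage A^-1%relation.
Proof.
move=> [[C e] [/= BC e0] CA]; exists (C, e) => // -[f g] /= [d d0 fg].
by apply: CA; exists d => // x Cx /=; rewrite distrC; exact: fg.
Qed.

Let tau_s_split A : tau_s_entourage A ->
  exists2 D, tau_s_entourage D & (D \; D)%relation `<=` A.
Proof.
move=> [[C e] [/= BC e0] CA]; exists (strong_born_ent C (e / 2)).
  by exists (C, e / 2) => //; split=> //=; rewrite divr_gt0.
move=> [f g] /= [h [d d0 fh] [d' d'0 hg]]; apply: CA => /=.
exists (Num.min d d'); first by rewrite lt_min d0.
move=> x [b Cb]; rewrite lt_min => /andP[xd xd'] /=.
rewrite (le_lt_trans (ler_distD (h x) _ _))// (splitr e) ltrD//.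
  by apply: fh; exists b.
by apply: hg; exists b.
Qed.

HB.instance Definition _ :=
  isUniform.Build (C_tau_s B) tau_s_filter tau_s_diagonal tau_s_inv tau_s_split.

End uniformity.
End function_spaces.

(* Main.v *)
(* Both topologies come from a uniformity generated by the entourages of the
   sets of a base of [B] with radii [1 / n], so u <= cf(B) because countably many
   copies of a family add only aleph_0 to its cardinality; and in general
   pi chi <= chi <= u. Conversely, inside each member of a local pi-base at 0
   pick a neighbourhood [C, e]^s[f]: the closures of the sets [C] so obtained
   form a base of [B], since near any point off the closure of [C] the function
   [f] can be altered at will without leaving [C, e]^s[f]. *)

From Pilot Require (* [charge.v] shadows [cadd]. *)
Import Defs.
From mathcomp Require Import all_boot all_order all_algebra.
From mathcomp Require Import all_classical all_reals all_analysis.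

(* [charge.v] shadows [cadd]. *)
Import Defs.

Set Implicit Arguments.
Unset Strict Implicit.
Unset Printing Implicit Defensive.

Import Order.TTheory GRing.Theory Num.Theory.
Import numFieldTopology.Exports.

Local Open Scope classical_set_scope.
Local Open Scope card_scope.
Local Open Scope ring_scope.

(* A maximal family [S] of pairwise disjoint injective sequences in [T] leaves
   only a finite set [r] uncovered; on the covered part the factor [nat] is
   absorbed by the index of the sequence, and [r * nat] is countable. *)
Lemma card_le_prod_nat (T : Type) : [set: T * nat] #<= [set: nat + T].
Proof.
(* One condition encodes both requirements: the case [f = g] gives injectivity, the case [f <> g]
   disjointness of the ranges. *)
pose P (S : set (nat -> T)) := forall f g m n, S f -> S g -> f m = g n ->
  f = g /\ m = n.
have [|S [PS maxS]] := @Zorn_bigcup (nat -> T) P.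
  move=> H HP tot f g m n [U HU Uf] [V HV Vg] fg.
  have [UV|VU] := tot _ _ HU HV.
    by apply: (HP _ HV) fg => //; exact: UV.
  by apply: (HP _ HU) fg => //; exact: VU.
pose r : set T := [set t | forall f n, S f -> f n <> t].
(* An infinite [r] would contain an injective sequence, which could be added to [S]. *)
have /countable_injP[c cinj] : countable r.
  apply: finite_set_countable; apply: contrapT => /infiniteP nr.
  have /card_le_inj[h hinj] : [set: nat] #<= [set: set_type r].
    by rewrite (card_le_eqr (card_setT r)).
  have rh n : r (val (h n)) by exact: set_valP.
  apply: (maxS (S `|` [set val \o h])).
    split=> [|sub]; first exact: subsetUl.
    have Sh : S (val \o h) by apply: sub; right.
    exact: (rh 0%N _ 0%N Sh).
  move=> f g m n [Sf|->] [Sg|->] /=; first exact: PS.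
  - by move/(rh n f m Sf).
  - by move/esym/(rh m g n Sg).
  - by move/val_inj/hinj.
have [d dP] : exists d : T -> (nat -> T) * nat,
    forall t, ~ r t -> S (d t).1 /\ (d t).1 (d t).2 = t.
  have h t : exists fn : (nat -> T) * nat, ~ r t -> S fn.1 /\ fn.1 fn.2 = t.
    have [rt|/existsNP[f /existsNP[n /not_implyP[Sf /contrapT fn]]]] :=
      pselect (r t); first by exists (fun=> t, 0%N).
    by exists (f, n).
  by exists (fun t => projT1 (cid (h t))) => t; case: cid.
(* Points of [r] are coded in [nat]; for a covered point [f n], the pair with [k] goes to the term
   of [f] whose index codes [(n, k)]. *)
pose phi (tk : T * nat) : nat + T := if pselect (r tk.1) is left _
  then inl (pickle (c tk.1, tk.2))
  else inr ((d tk.1).1 (pickle ((d tk.1).2, tk.2))).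
apply: (@inj_card _ _ phi) => -[t k] [u l]; rewrite /phi /=.
case: pselect => [rt|nrt]; case: pselect => [ru|nru] //= [].
  move/(pcan_inj pickleK) => [/cinj tu ->].
  by rewrite tu// inE.
have [[St dt] [Su du]] := (dP _ nrt, dP _ nru).
move=> /(PS _ _ _ _ St Su)[dtu] /(pcan_inj pickleK) [ntu ->].
by rewrite -dt -du dtu ntu.
Qed.

(** * Sums with [aleph0] and minimal cardinalities of families *)

Lemma cle_caddr (k l : cardinal) : cle l (cadd k l).
Proof.
rewrite -[X in cle X _]card_reprK; apply/cle_card_of.
by apply: (@inj_card _ _ inr) => x y [].
Qed.


(** The representatives inside [cadd] are only equipotent to [A] and [B], so injections are summed
    in both directions. *)
Lemma cadd_card_of (A B : Type) :
  cadd (card_of A) (card_of B) = card_of (A + B)%type.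
Proof.
have sum_le (A1 A2 B1 B2 : Type) : [set: A1] #<= [set: A2] ->
    [set: B1] #<= [set: B2] -> [set: A1 + B1] #<= [set: A2 + B2].
  move=> /card_le_inj[f finj] /card_le_inj[g ginj].
  apply: (@inj_card _ _ (fun x => match x with
    | inl a => inl (f a) | inr b => inr (g b) end)).
  by move=> [a|b] [a'|b'] //= [] => [/finj|/ginj] ->.
have /andP[A1 A2] : ([set: card_repr (card_of A)] #<= [set: A]) &&
    ([set: A] #<= [set: card_repr (card_of A)]).
  by rewrite -card_eq_le card_of_repr.
have /andP[B1 B2] : ([set: card_repr (card_of B)] #<= [set: B]) &&
    ([set: B] #<= [set: card_repr (card_of B)]).
  by rewrite -card_eq_le card_of_repr.
by apply: cle_anti; apply/cle_card_of; exact: sum_le.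
Qed.

(** The summand [aleph0] on the right absorbs a second copy of itself: even numbers receive the
    [aleph0] of the left side, odd numbers the elements of [k] sent into [nat]. *)
Lemma cle_aleph0 (k l : cardinal) :
  cle k (cadd aleph0 l) -> cle (cadd aleph0 k) (cadd aleph0 l).
Proof.
rewrite -(card_reprK k) -(card_reprK l) /aleph0 !cadd_card_of !cle_card_of.
move=> /card_le_inj[f finj].
apply: (@inj_card _ _ (fun x => match x with
  | inl n => inl n.*2
  | inr a => match f a with inl n => inl n.*2.+1 | inr b => inr b end end)).
move=> [m|a] [n|b] //=.
- by move=> [] /double_inj ->.
- by case: (f b) => // p [] /(congr1 odd); rewrite /= !odd_double.
- by case: (f a) => // p [] /(congr1 odd); rewrite /= !odd_double.
case fa: (f a) => [p|x]; case fb: (f b) => [q|y] // [].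
  by move=> /double_inj pq; congr inr; apply: finj; rewrite fa fb pq.
by move=> xy; congr inr; apply: finj; rewrite fa fb xy.
Qed.

Lemma cle_set_type (T U : Type) (F : set T) (G : set U) :
  cle (card_of (set_type F)) (card_of (set_type G)) <-> F #<= G.
Proof.
by rewrite cle_card_of (card_le_eql (card_setT F)) (card_le_eqr (card_setT G)).
Qed.

(** This absorbs the countably many radii attached to each member of a base. *)
Lemma card_le_range_nat (T U : Type) (F : set T) (f : set_type F * nat -> U) :
  cle (card_of (set_type (range f))) (cadd aleph0 (card_of (set_type F))).
Proof.
rewrite /aleph0 cadd_card_of cle_card_of (card_le_eql (card_setT (range f))).
apply: card_le_trans (card_le_prod_nat _); exact: card_image_le.
Qed.

Lemma min_card_le (T : Type) (P : set (set T) -> Prop) (F : set (set T)) :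
  P F -> cle (min_card P) (card_of (set_type F)).
Proof. by move=> PF; apply: cmin_le; exists F. Qed.

Lemma min_card_in (T : Type) (P : set (set T) -> Prop) : (exists F, P F) ->
  exists2 F, P F & min_card P = card_of (set_type F).
Proof.
move=> [F PF]; apply: (@cmin_in (fun k => exists2 F, P F & k = card_of (set_type F))).
by exists (card_of (set_type F)), F.
Qed.

(** Nonemptiness of [P] ensures that its minimum is attained and is not the default value of
    [cmin]. *)
Lemma min_card_mono (T U : Type) (P : set (set T) -> Prop)
    (Q : set (set U) -> Prop) : (exists F, P F) ->
  (forall F, P F -> exists2 G, Q G & G #<= F) ->
  cle (min_card Q) (min_card P).
Proof.
move=> /min_card_in[F PF ->] /(_ F PF)[G QG GF].
apply: cle_trans (min_card_le QG) _; exact/cle_set_type.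
Qed.

(** * Comparison of the local and uniform cardinal functions of a space *)

Section cardinal_function_inequalities.
Variable T : topologicalType.

Lemma local_base_open_nbhs (p : T) : local_base p (open_nbhs p).
Proof.
by split=> // V; rewrite nbhsE => -[U pU UV]; exists U.
Qed.

Lemma local_base_pi_base (p : T) (F : set (set T)) :
  local_base p F -> local_pi_base p F.
Proof.
by move=> [Fp Fb]; split=> // U /Fp[oU Up]; split=> //; exists p.
Qed.

Lemma pi_character_le : cle (pi_character T) (character T).
Proof.
apply: cle_aleph0; apply: cle_trans (cle_caddr _ _).
apply: (csupP _).2 => p; apply: cle_trans ((csupP _).1 p).
apply: min_card_mono; first by exists (open_nbhs p); exact: local_base_open_nbhs.
by move=> F /local_base_pi_base ?; exists F => //; exact: card_lexx.
Qed.

(** Sections of entourages are neighbourhoods of [p] but need not be open, hence the interiors. *)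
Lemma local_base_of_uniformity_base (p : T) (F : set (set (T * T))) :
  uniformity_base F ->
  local_base p [set (xsection A p)^° | A in F].
Proof.
move=> [E [[_ _ _ _ nbhsE'] FE Fb]]; split=> [_ [A /FE EA <-]|V].
  split; first exact: open_interior.
  by apply: nbhs_singleton; apply: nbhs_interior; rewrite nbhsE'; exists A.
rewrite nbhsE' => -[A /Fb[U FU UA] AV].
exists (xsection U p)^°; first by exists U.
apply: subset_trans AV; apply: subset_trans (@interior_subset _ _) _.
exact: le_xsection.
Qed.

Lemma character_le : (exists F, @uniformity_base T F) ->
  cle (character T) (uniform_weight T).
Proof.
move=> FT; apply: cle_aleph0; apply: cle_trans (cle_caddr _ _).
apply: (csupP _).2 => p; apply: min_card_mono => // F.
move=> /(local_base_of_uniformity_base p) ?.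
by eexists; [eassumption|exact: card_image_le].
Qed.

End cardinal_function_inequalities.

(** * Upper bound for the uniform weight *)

Lemma compatible_entourage (T : uniformType) :
  @compatible_uniformity T entourage.
Proof.
split.
- exact: entourage_filter.
- by move=> A EA [x y] /= xy; rewrite (xy : x = y); exact: entourage_refl.
- exact: entourage_inv.
- exact: entourage_split_ex.
- by rewrite nbhs_entourageE.
Qed.

(** This serves both topologies, with [ent A n] the entourage of [A] of radius [1 / (n + 1)].
    Quantifying over all [C] containing [A] allows [A] to be replaced by a member of a base. *)
Lemma uniform_weight_le (T : uniformType) (X : Type) (B : bornology X)
    (ent : set X -> nat -> set (T * T)) :
  (forall A n, bornology_set B A -> entourage (ent A n)) ->
  (forall E, entourage E ->
    exists2 A, bornology_set B A &
      exists n, forall C, A `<=` C -> ent C n `<=` E) ->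
  cle (uniform_weight T) (cf B).
Proof.
move=> ent_ent entP; apply: cle_aleph0.
have /min_card_in[F [FB Fb] ->] : exists F, bornology_base B F.
  by exists B; split=> // A BA; exists A.
apply: cle_trans
  (card_le_range_nat (fun An : set_type F * nat => ent (val An.1) An.2)).
apply: min_card_le; exists entourage; split.
- exact: compatible_entourage.
- by move=> _ [[A n] _ <-]; apply: ent_ent; apply: FB; exact: set_valP.
move=> E /entP[A /Fb[C FC AC] [n entE]].
by exists (ent C n); [exists (SigSub (mem_set FC), n)|exact: entE].
Qed.

(** * The bounds for the two topologies on the space of continuous functions *)

Section function_spaces.
Variables (R : realType) (X : metricType R) (B : bornology X).

Lemma born_ent_mono (A C : set X) (d e : R) :
  A `<=` C -> d <= e -> born_ent C d `<=` born_ent A e.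
Proof. by move=> AC de fg h x /AC/h/lt_le_trans; exact. Qed.

Lemma strong_born_ent_mono (A C : set X) (d e : R) :
  A `<=` C -> d <= e -> strong_born_ent C d `<=` strong_born_ent A e.
Proof.
move=> AC de fg [r r0 h]; exists r => // x [b /AC Cb xb].
by apply: lt_le_trans de; apply: h; exists b.
Qed.

Lemma strong_born_ent_sub (A : set X) (e : R) :
  strong_born_ent A e `<=` born_ent A e.
Proof. by move=> fg [r r0 h] x Ax; apply: h; exists x; rewrite ?mdistxx. Qed.

Lemma invS_le (e : R) : 0 < e -> exists n, n.+1%:R^-1 <= e.
Proof. by move=> /ltr_add_invr[n]; rewrite add0r => /ltW; exists n. Qed.

Lemma uniform_weight_tau : cle (uniform_weight (C_tau B)) (cf B).
Proof.
apply: (@uniform_weight_le (C_tau B) X B (fun A n => born_ent A n.+1%:R^-1)).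
  by move=> A n BA; exists (A, n.+1%:R^-1) => //; split=> //=; rewrite invr_gt0.
move=> E [[A e] /= [BA /invS_le[n ne]] AE]; exists A => //; exists n => C AC.
by apply: subset_trans AE; exact: born_ent_mono.
Qed.

Lemma uniform_weight_tau_s : cle (uniform_weight (C_tau_s B)) (cf B).
Proof.
apply: (@uniform_weight_le (C_tau_s B) X B (fun A n => strong_born_ent A n.+1%:R^-1)).
  by move=> A n BA; exists (A, n.+1%:R^-1) => //; split=> //=; rewrite invr_gt0.
move=> E [[A e] /= [BA /invS_le[n ne]] AE]; exists A => //; exists n => C AC.
by apply: subset_trans AE; exact: strong_born_ent_mono.
Qed.

(* [g] is [f] plus a tent supported in a small ball around [x]. *)
Lemma strong_born_ent_bump (A : set X) (e : R) (f : continuousType X R) x :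
  0 < e -> ~ closure A x ->
  exists2 g : continuousType X R, strong_born_ent A e (f, g) & g x = 1.
Proof.
move=> e0 nAx.
have [r r0 rA] : exists2 r, 0 < r & forall b, A b -> r <= mdist x b.
  apply: contrapT => h; apply: nAx => V /nbhs_ballP[r /= r0 rV].
  apply: contrapT => AV; apply: h; exists r => // b Ab.
  rewrite leNgt; apply/negP => xb; apply: AV; exists b; split=> //.
  by apply: rV; rewrite ballEmdist.
(* The tent has height [r / 2] at [x], so this factor makes [g x = 1]. *)
pose g y := f y + (1 - f x) / (r / 2) * Num.max 0 (r / 2 - mdist x y).
have r20 : 0 < r / 2 by rewrite divr_gt0.
have gc : continuous g.
  have dc : continuous (fun y => mdist x y : R).
    move=> y; apply/cvgrPdist_lt => d d0; apply/nbhs_ballP; exists d => //= z.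
    rewrite ballEmdist /= => yz; apply: le_lt_trans yz.
    rewrite ler_norml; apply/andP; split.
      by rewrite lerNl opprB lerBlDl metric_triangle.
    by rewrite lerBlDl addrC (metric_sym y z) addrC metric_triangle.
  move=> y; apply: cvgD; first exact: cts_fun.
  apply: cvgM; first exact: cvg_cst.
  apply: (@continuous_max _ _ (cst 0) (fun z => r / 2 - mdist x z)).
    exact: cvg_cst.
  by apply: cvgB; [exact: cvg_cst|exact: dc].
exists (mkcts gc : continuousType X R).
  (* By the triangle inequality, points within [r / 2] of [A] are at least [r / 2] away from [x],
     where the tent vanishes. *)
  exists (r / 2) => // y [b Ab yb] /=.
  have yr : r / 2 <= mdist x y.
    rewrite -(lerD2r (r / 2)) -splitr.
    apply: le_trans (rA _ Ab) (le_trans (metric_triangle x y b) _).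
    by rewrite lerD2l ltW.
  change (`|f y - g y| < e).
  by rewrite /g max_l ?subr_le0// mulr0 addr0 subrr normr0.
change (g x = 1); rewrite /g mdistxx subr0 max_r ?ltW// divfK ?gt_eqF//.
by rewrite addrC subrK.
Qed.

(* If [A] were not inside the closure of [C], then adding a bump at a point of
   [A] off that closure would leave the member of [F] without leaving its
   strong [C]-neighbourhood. *)
Lemma bornology_base_closures (F : set (set (continuousType X R))) :
  has_closed_base B ->
  (forall U, F U -> exists f C e, [/\ bornology_set B C, 0 < e &
     forall g, strong_born_ent C e (f, g) -> U g]) ->
  (forall A, bornology_set B A -> exists2 U, F U & forall g, U g ->
     forall x, A x -> `|g x| < 1) ->
  exists2 G, bornology_base B G & G #<= F.
Proof.
move=> [K [KB Kb] Kclosed] FU FA.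
have [c cP] : exists c : set (continuousType X R) -> set X, forall U, F U ->
    bornology_set B (c U) /\ exists f e, 0 < e /\
     forall g, strong_born_ent (c U) e (f, g) -> U g.
  have h U : exists C, F U -> bornology_set B C /\ exists f e, 0 < e /\
      forall g, strong_born_ent C e (f, g) -> U g.
    have [/FU[f [C [e [BC e0 CU]]]]|] := pselect (F U); last by exists set0.
    by exists C => _; split=> //; exists f, e.
  by exists (fun U => projT1 (cid (h U))) => U; case: cid.
exists [set closure (c U) | U in F]; last exact: card_image_le.
(* A closed member [D] of the base containing [c U] also contains its closure, which therefore lies
   in [B]. *)
split=> [_ [U /cP[/Kb[D KD cD] _] <-]|A /FA[U FU' UA]].
  apply: (bornology_sub (KB _ KD)).
  by rewrite (closure_id D).1; [exact: closure_subset|exact: Kclosed].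
exists (closure (c U)); first by exists U.
move=> x Ax; apply: contrapT => ncx.
have [_ [f [e [e0 cU]]]] := cP _ FU'.
have [g /cU Ug gx] := strong_born_ent_bump f e0 ncx.
by have := UA _ Ug _ Ax; rewrite gx normr1 ltxx.
Qed.

(** The supremum dominates its term at the zero function [z], where the neighbourhood given by [A]
    and radius 1 forces [|g| < 1] on [A]. *)
Lemma cf_le_pi_character_tau : has_closed_base B ->
  cle (cf B) (pi_character (C_tau B)).
Proof.
move=> closedB; apply: cle_aleph0; apply: cle_trans (cle_caddr _ _).
pose z : C_tau B := mkcts (@cst_continuous X R 0).
apply: cle_trans ((csupP _).1 z); apply: min_card_mono.
  by exists (open_nbhs z); exact/local_base_pi_base/local_base_open_nbhs.
move=> F [Fopen Fz]; apply: bornology_base_closures => //.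
  move=> U /Fopen[oU [f Uf]].
  have : nbhs f U by exact: open_nbhs_nbhs.
  rewrite -nbhs_entourageE => -[E [[C e] /= [BC e0] CE] EU].
  exists f, C, e; split=> // g fg.
  (* The strong neighbourhood of [f] is the smaller one, so it also lies in [U]. *)
  by apply: EU; apply/xsectionP; apply: CE; exact: strong_born_ent_sub.
move=> A BA; have zA : nbhs z (xsection (born_ent A 1) z).
  by apply: nbhs_entourage; exists (A, 1) => //; split=> //=; exact: ltr01.
have [U FU UA] := Fz _ zA; exists U => // g /UA/xsectionP.
by move=> zg x /zg; rewrite /= sub0r normrN.
Qed.

Lemma cf_le_pi_character_tau_s : has_closed_base B ->
  cle (cf B) (pi_character (C_tau_s B)).
Proof.
move=> closedB; apply: cle_aleph0; apply: cle_trans (cle_caddr _ _).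
pose z : C_tau_s B := mkcts (@cst_continuous X R 0).
apply: cle_trans ((csupP _).1 z); apply: min_card_mono.
  by exists (open_nbhs z); exact/local_base_pi_base/local_base_open_nbhs.
move=> F [Fopen Fz]; apply: bornology_base_closures => //.
  move=> U /Fopen[oU [f Uf]].
  have : nbhs f U by exact: open_nbhs_nbhs.
  rewrite -nbhs_entourageE => -[E [[C e] /= [BC e0] CE] EU].
  exists f, C, e; split=> // g fg.
  by apply: EU; apply/xsectionP; apply: CE.
move=> A BA; have zA : nbhs z (xsection (strong_born_ent A 1) z).
  by apply: nbhs_entourage; exists (A, 1) => //; split=> //=; exact: ltr01.
have [U FU UA] := Fz _ zA; exists U => // g /UA/xsectionP.
move=> /strong_born_ent_sub zg.
by move=> x /zg; rewrite /= sub0r normrN.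
Qed.

End function_spaces.

Theorem theorem3p2 (R : realType) (X : metricType R) (B : bornology X)
    (closed_base : has_closed_base B) :
  pi_character (C_tau B) = pi_character (C_tau_s B) /\
  pi_character (C_tau_s B) = character (C_tau B) /\
  character (C_tau B) = character (C_tau_s B) /\
  character (C_tau_s B) = uniform_weight (C_tau B) /\
  uniform_weight (C_tau B) = uniform_weight (C_tau_s B) /\
  uniform_weight (C_tau_s B) = cf B.
Proof.
(* The chain from [cf B] through the three functions back to [cf B] closes up, so antisymmetry makes
   all terms equal. *)
have squeeze (T : uniformType) : cle (cf B) (pi_character T) ->
    cle (uniform_weight T) (cf B) ->
    [/\ pi_character T = cf B, character T = cf B & uniform_weight T = cf B].
  move=> cf_pi weight_cf; have pi_chi := pi_character_le T.
  have chi_weight : cle (character T) (uniform_weight T).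
    (* The set of all entourages is itself a base, so the minimum defining the uniform weight is
       attained. *)
    by apply: character_le; exists entourage, entourage; split=> //;
      [exact: compatible_entourage|move=> A EA; exists A].
  have chi_cf := cle_trans chi_weight weight_cf.
  have cf_chi := cle_trans cf_pi pi_chi.
  split; apply: cle_anti => //; first exact: cle_trans pi_chi chi_cf.
  exact: cle_trans cf_chi chi_weight.
have [-> -> ->] := squeeze (C_tau B) (cf_le_pi_character_tau closed_base)
  (uniform_weight_tau B).
have [-> -> ->] := squeeze (C_tau_s B) (cf_le_pi_character_tau_s closed_base)
  (uniform_weight_tau_s B).
by [].
Qed.
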